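(* Let $H$ be a commutative bialgebra over $\mathbb{K}$, let $L \in HZ^1_{\varepsilon}(H)$ be a 1-cocycle and let $\alpha \in H' = \mathrm{Hom}(H,\mathbb{K})$ be a linear functional. Then, with ${}^{L}\!\rho,\ {}^{L+\partial\alpha}\!\rho : H_R \to H$ the algebra morphisms induced by $L$ and $L+\partial\alpha$, and ${}^{\alpha\circ {}^{L}\!\rho}\chi : H_R\to H_R$ the algebra endomorphism attached to the functional $\alpha\circ{}^{L}\!\rho\in H_R'$, one has $$ {}^{L+\partial\alpha}\!\rho \;=\; {}^{L}\!\rho \circ {}^{[\alpha\,\circ\,{}^{L}\!\rho]}\chi .$$
   Context: $\mathbb{K}$ is a field of characteristic zero; all spaces, tensor products and $\mathrm{Hom}$ (linear maps) are over $\mathbb{K}$; algebras are associative and unital; bialgebras are nonzero, unital and counital. Hopf algebra $H_R$ of rooted trees: a rooted tree is an isomorphism class of finite (nonempty, unordered) trees with a distinguished root; $\mathcal{T}$ is the set of rooted trees and $\mathcal{F}$ the set of rooted forests, i.e. finite multisets of rooted trees, including the empty forest $\mathbf 1$. $H_R=\mathbb{K}[\mathcal{T}]$ is the free commutative algebra on $\mathcal{T}$; $\mathcal{F}$ is a basis, the product being disjoint union. $B_+:H_R\to H_R$ is the linear map sending a forest $f$ to the tree obtained by attaching all roots of $f$ as children to a new root ($B_+(\mathbf 1)$ is the one-node tree). $\Delta$ is the unique unital algebra morphism with $\Delta\circ B_+=B_+\otimes\mathbf 1+(\mathrm{id}\otimes B_+)\circ\Delta$, and $\varepsilon(\mathbf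 1)=1$, $\varepsilon(f)=0$ for forests $f\neq\mathbf 1$. Cocycles: for a bialgebra $H$, $HZ^1_\varepsilon(H)$ is the space of linear $L:H\to H$ with $\Delta\circ L=(\mathrm{id}\otimes L)\circ\Delta+L\otimes\mathbf 1$. For $\alpha\in H'$, the coboundary $\partial\alpha:H\to H$ is $\partial\alpha=(\mathrm{id}\otimes\alpha)\circ\Delta-\alpha(\cdot)\mathbf 1$; it is a 1-cocycle. Induced morphisms: for a commutative unital algebra $\mathcal{A}$ and a linear map $L:\mathcal{A}\to\mathcal{A}$, ${}^{L}\!\rho:H_R\to\mathcal{A}$ denotes the unique morphism of unital algebras with ${}^{L}\!\rho\circ B_+=L\circ{}^{L}\!\rho$. For $\beta\in H_R'$, ${}^{\beta}\chi:={}^{B_++\partial\beta}\!\rho:H_R\to H_R$, i.e. the unique unital algebra endomorphism with ${}^{\beta}\chi\circ B_+=(B_++\partial\beta)\circ{}^{\beta}\chi$. *)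

(* Defs.v *)
(* Classical logic (boolp) is used to form quotients by undecidable relations *)
(* and to choose linear forms.                                               *)

From HB Require Import structures.
From mathcomp Require Import all_boot all_algebra.
From mathcomp Require Import finmap monalg generic_quotient ring_quotient.
From mathcomp Require Import sesquilinear boolp classical_sets.

Set Implicit Arguments.
Unset Strict Implicit.
Unset Printing Implicit Defensive.

Import GRing.Theory.

Local Open Scope ring_scope.
Local Open Scope quotient_scope.

Section LinearExtension.
Variables (K : fieldType) (I : choiceType) (V : lmodType K).

Definition lin_ext (h : I -> V) (g : {malg K[I]}) : V :=
  \sum_(i <- msupp g) g@_i *: h i.

Lemma lin_extEw (h : I -> V) (d : {fset I}) (g : {malg K[I]}) :
  fsubset (msupp g) d -> lin_ext h g = \sum_(i <- d) g@_i *: h i.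
Proof.
move=> le; rewrite /lin_ext (big_fset_incl _ le) // => i _ /mcoeff_outdom ->.
by rewrite scale0r.
Qed.

Fact lin_ext_is_linear (h : I -> V) : linear (lin_ext h).
Proof.
move=> a g1 g2; pose d := fsetU (msupp g1) (msupp g2).
have l1 : fsubset (msupp g1) d by apply: fsubsetUl.
have l2 : fsubset (msupp g2) d by apply: fsubsetUr.
rewrite (@lin_extEw h d (a *: g1 + g2)); last first.
  apply: fsubset_trans (msuppD_le _ _) _; rewrite fsubUset l2 andbT.
  exact: fsubset_trans (msuppZ_le _ _) l1.
rewrite (lin_extEw _ l1) (lin_extEw _ l2) scaler_sumr -big_split /=.
by apply: eq_bigr => i _; rewrite mcoeffD mcoeffZ scalerDl scalerA.
Qed.

HB.instance Definition _ (h : I -> V) :=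
  GRing.isLinear.Build K {malg K[I]} V *:%R (lin_ext h) (lin_ext_is_linear h).

Lemma lin_extU (h : I -> V) i : lin_ext h << i >> = h i.
Proof.
by rewrite (@lin_extEw h [fset i]%fset) ?msuppU_le // big_seq_fset1 mcoeffUU scale1r.
Qed.

End LinearExtension.

(* U (x) V is the free K-module on U * V modulo the span of the bilinearity   *)
(* relations.                                                                *)
Section TensorDef.
Variables (K : fieldType) (U V : lmodType K).

Inductive tensor_rel : {malg K[(U * V)%type]} -> Prop :=
| tensor_rel0 : tensor_rel 0
| tensor_relD a x y :
    tensor_rel x -> tensor_rel y -> tensor_rel (a *: x + y)
| tensor_rell a u1 u2 v :
    tensor_rel (<< (a *: u1 + u2, v) >> - (a *: << (u1, v) >> + << (u2, v) >>))
| tensor_relr a u v1 v2 :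
    tensor_rel (<< (u, a *: v1 + v2) >> - (a *: << (u, v1) >> + << (u, v2) >>)).

Definition tensor_relb (x : {malg K[(U * V)%type]}) : bool := `[< tensor_rel x >].

Fact tensor_relb_zmod : zmod_closed tensor_relb.
Proof.
split=> [|x y /asboolP xR /asboolP yR]; apply/asboolP; first exact: tensor_rel0.
by rewrite -scaleN1r addrC; apply: tensor_relD.
Qed.

Definition tensor_null : zmodClosed {malg K[(U * V)%type]} :=
  HB.pack tensor_relb (GRing.isZmodClosed.Build _ _ tensor_relb_zmod).

Definition tensor : Type := Quotient.quot tensor_null.

HB.instance Definition _ := GRing.Zmodule.on tensor.

End TensorDef.

(* The operations below are locked only to keep unification from unfolding   *)
(* the quotient.                                                             *)
HB.lock Definition tensor_pi (K : fieldType) (U V : lmodType K)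
    (x : {malg K[(U * V)%type]}) : tensor U V :=
  \pi_(Quotient.quot (tensor_null U V)) x.
Arguments tensor_pi {K U V} x.

HB.lock Definition tensor_repr (K : fieldType) (U V : lmodType K)
    (x : tensor U V) : {malg K[(U * V)%type]} :=
  repr (x : Quotient.quot (tensor_null U V)).
Arguments tensor_repr {K U V} x.

HB.lock Definition tensor_scale (K : fieldType) (U V : lmodType K)
    (a : K) (x : tensor U V) : tensor U V :=
  tensor_pi (a *: tensor_repr x).
Arguments tensor_scale {K U V} a x.

Section TensorModule.
Variables (K : fieldType) (U V : lmodType K).
Local Notation piT := (@tensor_pi K U V).
Local Notation repT := (@tensor_repr K U V).

Lemma tensor_reprK x : piT (repT x) = x.
Proof. by rewrite tensor_pi.unlock tensor_repr.unlock; exact: reprK. Qed.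

Lemma tensor_piP x y : piT x = piT y <-> tensor_rel (x - y).
Proof.
rewrite tensor_pi.unlock.
split; first by move/eqP; rewrite -Quotient.idealrBE => /asboolP.
by move=> xy; apply/eqP; rewrite -Quotient.idealrBE; apply/asboolP.
Qed.

Lemma tensor_pi0 : piT 0 = 0.
Proof.
rewrite tensor_pi.unlock.
exact: (raddf0 (\pi_(Quotient.quot (tensor_null U V)))).
Qed.

Lemma tensor_piD x y : piT (x + y) = piT x + piT y.
Proof.
rewrite tensor_pi.unlock.
exact: (raddfD (\pi_(Quotient.quot (tensor_null U V)))).
Qed.

Let piTZ a x : piT (a *: x) = tensor_scale a (piT x).
Proof.
rewrite tensor_scale.unlock; apply/tensor_piP.
rewrite -scalerBr -[_ *: _]addr0; apply: tensor_relD; last exact: tensor_rel0.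
by apply/tensor_piP; rewrite tensor_reprK.
Qed.

Fact tensor_scaleA a b (x : tensor U V) :
  tensor_scale a (tensor_scale b x) = tensor_scale (a * b) x.
Proof. by rewrite -[x]tensor_reprK -!piTZ scalerA. Qed.
Fact tensor_scale1 : left_id 1 (@tensor_scale K U V).
Proof. by move=> x; rewrite -[x]tensor_reprK -piTZ scale1r. Qed.
Fact tensor_scaleDr : right_distributive (@tensor_scale K U V) +%R.
Proof.
move=> a x y; rewrite -[x]tensor_reprK -[y]tensor_reprK.
by rewrite -tensor_piD -!piTZ -tensor_piD scalerDr.
Qed.
Fact tensor_scaleDl (x : tensor U V) : {morph tensor_scale^~ x : a b / a + b}.
Proof.
by move=> a b; rewrite -[x]tensor_reprK -!piTZ -tensor_piD scalerDl.
Qed.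

HB.instance Definition _ := GRing.Zmodule_isLmodule.Build K (tensor U V)
  tensor_scaleA tensor_scale1 tensor_scaleDr tensor_scaleDl.

Lemma tensor_piZ a x : piT (a *: x) = a *: piT x.
Proof. exact: piTZ. Qed.

End TensorModule.

HB.lock Definition tens (K : fieldType) (U V : lmodType K)
  (u : U) (v : V) : tensor U V := tensor_pi << (u, v) >>.
Arguments tens {K U V} u v.

(* The linear map U (x) V -> W induced by f. It is defined for every function *)
(* f, through representatives, and is meaningful when f is bilinear; see      *)
(* tensor_liftE and tensor_liftP.                                            *)
HB.lock Definition tensor_lift (K : fieldType) (U V W : lmodType K)
    (f : U -> V -> W) (x : tensor U V) : W :=
  lin_ext (fun p => f p.1 p.2) (tensor_repr x).
Arguments tensor_lift {K U V W} f x.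

Section TensorTheory.
Variables (K : fieldType) (U V : lmodType K).

Fact tens_is_bilinear : bilinear_for *:%R *:%R (@tens K U V).
Proof.
split=> [v|u] a x y /=; rewrite tens.unlock -tensor_piZ -tensor_piD.
  apply/tensor_piP; exact: tensor_rell.
apply/tensor_piP; exact: tensor_relr.
Qed.

HB.instance Definition _ := bilinear_isBilinear.Build K U V (tensor U V)
  *:%R *:%R (@tens K U V) tens_is_bilinear.

Lemma tensPl k u1 u2 (v : V) :
  tens (k *: u1 + u2 : U) v = k *: tens u1 v + tens u2 v.
Proof. exact: tens_is_bilinear.1. Qed.

Lemma tensPr k (u : U) v1 v2 :
  tens u (k *: v1 + v2 : V) = k *: tens u v1 + tens u v2.
Proof. exact: tens_is_bilinear.2. Qed.

Lemma tensor_ind (P : tensor U V -> Prop) :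
  (forall k x y, P x -> P y -> P (k *: x + y)) ->
  (forall u v, P (tens u v)) -> forall x, P x.
Proof.
move=> Plin Ptens x; rewrite -[x]tensor_reprK [tensor_repr x]monalgE.
have P0 : P 0.
  by have := Plin (-1) _ _ (Ptens 0 0) (Ptens 0 0); rewrite scaleN1r addNr.
elim: (msupp _ : seq _) => [|[u v] s IHs]; first by rewrite big_nil tensor_pi0.
rewrite big_cons tensor_piD.
set c := _@_(u, v).
have -> : << c *g (u, v) >> = c *: << (u, v) >> :> {malg K[(U * V)%type]}.
  by apply/malgP => k; rewrite mcoeffZ !mcoeffU mulrnAr mulr1.
by rewrite tensor_piZ; apply: Plin => //; have := Ptens u v; rewrite tens.unlock.
Qed.

Variable W : lmodType K.
Implicit Types f g : U -> V -> W.

Section Bilinear.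
Variable f : U -> V -> W.
Hypothesis fbil : bilinear_for *:%R *:%R f.

Let lift_pi x : tensor_lift f (tensor_pi x) = lin_ext (fun p => f p.1 p.2) x.
Proof.
have /tensor_piP xR := tensor_reprK (tensor_pi x).
apply/eqP; rewrite -subr_eq0 tensor_lift.unlock -linearB /=.
elim: xR => {x} [|a x y _ /eqP IHx _ /eqP IHy|a u1 u2 v|a u v1 v2].
- by rewrite linear0.
- by rewrite linearP /= IHx IHy scaler0 addr0.
- by rewrite linearB linearP /= !lin_extU /= fbil.1 subrr.
- by rewrite linearB linearP /= !lin_extU /= fbil.2 subrr.
Qed.

Lemma tensor_liftE u v : tensor_lift f (tens u v) = f u v.
Proof. by rewrite tens.unlock lift_pi lin_extU. Qed.

Lemma tensor_liftP k x y :
  tensor_lift f (k *: x + y) = k *: tensor_lift f x + tensor_lift f y.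
Proof.
rewrite -[x]tensor_reprK -[y]tensor_reprK -tensor_piZ -tensor_piD !lift_pi.
exact: linearP.
Qed.

End Bilinear.

Lemma tensor_lift_ext f g : f =2 g -> tensor_lift f =1 tensor_lift g.
Proof.
by move=> fg x; rewrite tensor_lift.unlock; apply: eq_bigr => i _; rewrite fg.
Qed.

Lemma tensor_lift_lin k f g x :
  tensor_lift (fun u v => k *: f u v + g u v) x =
  k *: tensor_lift f x + tensor_lift g x.
Proof.
rewrite tensor_lift.unlock /lin_ext scaler_sumr -big_split /=.
by apply: eq_bigr => i _; rewrite scalerDr !scalerA mulrC.
Qed.

End TensorTheory.

(* Used to show that 1 (x) 1 != 0 for nonzero algebras over a field. *)
Section Functional.
Variables (K : fieldType) (V : lmodType K) (v : V).
Hypothesis v0 : v != 0.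

Lemma exists_linear_form : exists f : V -> K^o, linear f /\ f v = 1.
Proof.
pose closed (M : set V) := forall a x y, M x -> M y -> M (a *: x + y).
have [|A [[Acl Av] Amax]] := @Zorn_bigcup V (fun M => closed M /\ ~ M v).
  move=> F FP tot; split; last by move=> [X FX]; exact: (FP X FX).2.
  move=> a x y [X FX Xx] [Y FY Yy].
  have [XY|YX] := tot X Y FX FY.
    by exists Y => //; apply: (FP Y FY).1 => //; apply: XY.
  by exists X => //; apply: (FP X FX).1 => //; apply: YX.
have A0 : A 0.
  apply: contrapT => nA0; apply: (Amax (fun x => x = 0)).
    split=> [|/(_ 0 erefl)] // x Ax; exfalso; apply: nA0.
    by have := Acl (-1) x x Ax Ax; rewrite scaleN1r addNr.
  by split=> [a x y -> ->|/eqP]; rewrite ?scaler0 ?addr0 //; apply/negP.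
have AZ a x : A x -> A (a *: x) by move=> Ax; rewrite -[_ *: _]addr0; apply: Acl.
have AD x y : A x -> A y -> A (x + y).
  by move=> Ax Ay; rewrite -[x]scale1r; apply: Acl.
have dec x : exists c : K, A (x - c *: v).
  have [Ax|nAx] := pselect (A x); first by exists 0; rewrite scale0r subr0.
  apply: contrapT => nc.
  apply: (Amax (fun y => exists a m, A m /\ y = a *: x + m)).
    split=> [m Am|]; first by exists 0, m; rewrite scale0r add0r.
    by move/(_ x) => H; apply: nAx; apply: H; exists 1, 0; rewrite scale1r addr0.
  split=> [b _ _ [a1 [m1 [A1 ->]]] [a2 [m2 [A2 ->]]]|[a [m [Am vE]]]].
    exists (b * a1 + a2), (b *: m1 + m2); split; first exact: Acl.
    by rewrite scalerDr scalerA scalerDl addrACA.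
  have [a0|an0] := eqVneq a 0.
    by apply: Av; rewrite vE a0 scale0r add0r.
  apply: nc; exists a^-1.
  rewrite vE scalerDr scalerA mulVf // scale1r opprD addrA subrr add0r -scaleNr.
  exact: AZ.
have uniq c d x : A (x - c *: v) -> A (x - d *: v) -> c = d.
  move=> Ac Ad; apply/eqP; rewrite -subr_eq0; apply/negP => /negP cd; apply: Av.
  have := AZ (c - d)^-1 _ (AD _ _ Ad (AZ (-1) _ Ac)).
  rewrite scaleN1r opprB [X in _ *: X]addrC addrA addrNK -scalerBl scalerA.
  by rewrite mulVf // scale1r.
pose f x : K^o := projT1 (cid (dec x)).
have fP x : A (x - f x *: v) := projT2 (cid (dec x)).
exists f; split=> [a x y|]; last by apply: (uniq _ _ v) => //; rewrite scale1r subrr.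
apply: (uniq _ _ (a *: x + y)) => //.
rewrite scalerDl -scalerA opprD addrACA -scalerBr; apply: Acl; exact: fP.
Qed.

End Functional.

HB.lock Definition tensor_mul (K : fieldType) (A B : comAlgType K)
    (x y : tensor A B) : tensor A B :=
  tensor_lift (fun a b => tensor_lift (fun c d => tens (a * c) (b * d)) y) x.
Arguments tensor_mul {K A B} x y.

Section TensorAlgebra.
Variables (K : fieldType) (A B : comAlgType K).
Local Notation AB := (tensor A B).

Let inner_bil a b :
  bilinear_for *:%R *:%R (fun (c : A) (d : B) => tens (a * c) (b * d)).
Proof.
split=> [d|c] k u w /=; rewrite mulrDr -scalerAr.
  exact: tensPl.
exact: tensPr.
Qed.

Let outer_bil (y : AB) : bilinear_for *:%R *:%R
  (fun a b => tensor_lift (fun c d => tens (a * c) (b * d)) y).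
Proof.
split=> [b|a] k u w /=; rewrite -tensor_lift_lin; apply: tensor_lift_ext => c d.
  by rewrite mulrDl -scalerAl; exact: tensPl.
by rewrite mulrDl -scalerAl; exact: tensPr.
Qed.

Fact tensor_mulE (a : A) (b : B) c d :
  tensor_mul (tens a b) (tens c d) = tens (a * c) (b * d).
Proof. by rewrite tensor_mul.unlock (tensor_liftE (outer_bil _)) (tensor_liftE (inner_bil _ _)). Qed.

Fact tensor_mul_linl k (x y z : AB) :
  tensor_mul (k *: x + y) z = k *: tensor_mul x z + tensor_mul y z.
Proof. by rewrite tensor_mul.unlock; exact: tensor_liftP (outer_bil z) _ _ _. Qed.

Fact tensor_mul_linr k (x y z : AB) :
  tensor_mul x (k *: y + z) = k *: tensor_mul x y + tensor_mul x z.
Proof.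
rewrite tensor_mul.unlock -tensor_lift_lin; apply: tensor_lift_ext => a b.
exact: tensor_liftP (inner_bil a b) _ _ _.
Qed.

Fact tensor_mulC : commutative (@tensor_mul K A B).
Proof.
move=> x y; elim/tensor_ind: x => [k x x' IH IH'|a b].
  by rewrite tensor_mul_linl tensor_mul_linr IH IH'.
elim/tensor_ind: y => [k y y' IH IH'|c d].
  by rewrite tensor_mul_linl tensor_mul_linr IH IH'.
by rewrite !tensor_mulE mulrC [b * d]mulrC.
Qed.

Fact tensor_mulA : associative (@tensor_mul K A B).
Proof.
move=> x y z; elim/tensor_ind: x => [k x x' IH IH'|a b].
  by rewrite !tensor_mul_linl IH IH'.
elim/tensor_ind: y => [k y y' IH IH'|c d].
  by rewrite !(tensor_mul_linl, tensor_mul_linr) IH IH'.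
elim/tensor_ind: z => [k z z' IH IH'|e f].
  by rewrite !tensor_mul_linr IH IH'.
by rewrite !tensor_mulE !mulrA.
Qed.

Fact tensor_mul1 : left_id (tens 1 1) (@tensor_mul K A B).
Proof.
move=> x; elim/tensor_ind: x => [k x y IH IH'|a b].
  by rewrite tensor_mul_linr IH IH'.
by rewrite tensor_mulE !mul1r.
Qed.

Fact tensor_mulDl : left_distributive (@tensor_mul K A B) +%R.
Proof.
by move=> x y z; have := tensor_mul_linl 1 x y z; rewrite !scale1r.
Qed.

Fact tensor_1_neq0 : (tens 1 1 : AB) != 0.
Proof.
have [f [flin f1]] := exists_linear_form (oner_neq0 A).
have [g [glin g1]] := exists_linear_form (oner_neq0 B).
have fgbil : bilinear_for *:%R *:%R (fun a b => f a * g b : K^o).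
  split=> [b|a] k x y /=; first by rewrite flin mulrDl -scalerAl.
  by rewrite glin mulrDr -scalerAr.
have := tensor_liftE fgbil 1 1; rewrite f1 g1 mulr1.
apply: contra_eq_neq => ->.
have := tensor_liftP fgbil (-1) 0 0.
rewrite scaler0 addr0 scaleN1r addNr => ->.
by rewrite eq_sym oner_neq0.
Qed.

HB.instance Definition _ := GRing.Zmodule_isComNzRing.Build AB
  tensor_mulA tensor_mulC tensor_mul1 tensor_mulDl tensor_1_neq0.

Fact tensor_scaleAl k (x y : AB) : k *: (x * y) = (k *: x) * y.
Proof.
rewrite -[k *: x]addr0 [RHS]tensor_mul_linl.
by rewrite [X in _ = _ + X](mul0r y) addr0.
Qed.

HB.instance Definition _ := GRing.Lmodule_isLalgebra.Build K AB tensor_scaleAl.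
HB.instance Definition _ := GRing.Lalgebra_isComAlgebra.Build K AB.

Lemma tensM a b c d : tens a b * tens c d = tens (a * c) (b * d) :> AB.
Proof. exact: tensor_mulE. Qed.

Lemma tens1 : tens 1 1 = 1 :> AB. Proof. by []. Qed.

End TensorAlgebra.

Section TensorMaps.
Variable K : fieldType.

Definition tensor_map (U U' V V' : lmodType K) (f : U -> U') (g : V -> V') :
  tensor U V -> tensor U' V' := tensor_lift (fun u v => tens (f u) (g v)).

Definition tensor_assoc (U V W : lmodType K) :
    tensor (tensor U V) W -> tensor U (tensor V W) :=
  tensor_lift (fun x w => tensor_lift (fun u v => tens u (tens v w)) x).

Lemma tens_scalel (U V : lmodType K) k (u : U) (v : V) :
  tens (k *: u) v = k *: tens u v.
Proof. exact: (linearZl_LR (@tens K U V)). Qed.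

Lemma tens_scaler (U V : lmodType K) k (u : U) (v : V) :
  tens u (k *: v) = k *: tens u v.
Proof. exact: linearZr. Qed.

Section Map.
Variables (U U' V V' : lmodType K).
Variables (f : {linear U -> U'}) (g : {linear V -> V'}).

Fact tensor_map_bilinear :
  bilinear_for *:%R *:%R (fun u v => tens (f u) (g v)).
Proof. by split=> [v|u] k x y /=; rewrite linearP (tensPl, tensPr). Qed.

Lemma tensor_mapE u v : tensor_map f g (tens u v) = tens (f u) (g v).
Proof. exact: tensor_liftE tensor_map_bilinear _ _. Qed.

Fact tensor_map_is_linear : linear (tensor_map f g).
Proof. exact: tensor_liftP tensor_map_bilinear. Qed.

Lemma tensor_mapP k x y :
  tensor_map f g (k *: x + y) = k *: tensor_map f g x + tensor_map f g y.
Proof. exact: tensor_map_is_linear. Qed.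

HB.instance Definition _ := GRing.isLinear.Build K (tensor U V) (tensor U' V')
  *:%R (tensor_map f g) tensor_map_is_linear.
End Map.

Section Assoc.
Variables U V W : lmodType K.

Let inner_bil (w : W) :
  bilinear_for *:%R *:%R (fun (u : U) (v : V) => tens u (tens v w)).
Proof. by split=> [v|u] k x y /=; rewrite !(tensPl, tensPr). Qed.

Let outer_bil : bilinear_for *:%R *:%R (fun (x : tensor U V) (w : W) =>
  tensor_lift (fun u v => tens u (tens v w)) x).
Proof.
split=> [w|x] k y z /=; first by rewrite (tensor_liftP (inner_bil w)).
by rewrite -tensor_lift_lin; apply: tensor_lift_ext => u v; rewrite !tensPr.
Qed.

Lemma tensor_assocE (u : U) (v : V) (w : W) :
  tensor_assoc (tens (tens u v) w) = tens u (tens v w).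
Proof. by rewrite /tensor_assoc (tensor_liftE outer_bil) (tensor_liftE (inner_bil w)). Qed.

Fact tensor_assoc_is_linear : linear (@tensor_assoc U V W).
Proof. exact: tensor_liftP outer_bil. Qed.

Lemma tensor_assocP k (x y : tensor (tensor U V) W) :
  tensor_assoc (k *: x + y) = k *: tensor_assoc x + tensor_assoc y.
Proof. exact: tensor_assoc_is_linear. Qed.

HB.instance Definition _ := GRing.isLinear.Build K _ _
  *:%R (@tensor_assoc U V W) tensor_assoc_is_linear.
End Assoc.

Section MapMul.
Variables (A A' B B' C : comAlgType K).
Variables (f : {lrmorphism A -> A'}) (g : {lrmorphism B -> B'}).

Fact tensor_map_is_monoid_morphism : monoid_morphism (tensor_map f g).
Proof.
split=> [|x y]; first by rewrite -!tens1 tensor_mapE !rmorph1.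
elim/tensor_ind: x => [k x x' IH IH'|a b].
  by rewrite mulrDl -scalerAl !tensor_mapP IH IH' mulrDl -scalerAl.
elim/tensor_ind: y => [k y y' IH IH'|c d].
  by rewrite mulrDr -scalerAr !tensor_mapP IH IH' mulrDr -scalerAr.
by rewrite tensM !tensor_mapE !rmorphM tensM.
Qed.

HB.instance Definition _ := GRing.isMonoidMorphism.Build (tensor A B)
  (tensor A' B') (tensor_map f g) tensor_map_is_monoid_morphism.

Fact tensor_assoc_is_monoid_morphism : monoid_morphism (@tensor_assoc A B C).
Proof.
split=> [|x y]; first by rewrite -!tens1 tensor_assocE.
elim/tensor_ind: x => [k x x' IH IH'|ab c].
  by rewrite mulrDl -scalerAl !tensor_assocP IH IH' mulrDl -scalerAl.
elim/tensor_ind: ab => [k x x' IH IH'|a b].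
  by rewrite tensPl mulrDl -scalerAl !tensor_assocP IH IH' mulrDl -scalerAl.
elim/tensor_ind: y => [k y y' IH IH'|ab' c'].
  by rewrite mulrDr -scalerAr !tensor_assocP IH IH' mulrDr -scalerAr.
elim/tensor_ind: ab' => [k x x' IH IH'|a' b'].
  by rewrite tensPl mulrDr -scalerAr !tensor_assocP IH IH' mulrDr -scalerAr.
by rewrite !(tensM, tensor_assocE).
Qed.

HB.instance Definition _ := GRing.isMonoidMorphism.Build (tensor (tensor A B) C)
  (tensor A (tensor B C)) (@tensor_assoc A B C) tensor_assoc_is_monoid_morphism.
End MapMul.

End TensorMaps.

(* [counitl] and [counitr] are (epsilon (x) id) \o Delta = id and             *)
(* (id (x) epsilon) \o Delta = id, with K (x) H and H (x) K identified with H. *)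
HB.mixin Record isComBialgebra (K : fieldType) H of GRing.ComAlgebra K H := {
  comul : {lrmorphism H -> tensor H H};
  counit : {lrmorphism H -> K | *%R};
  comulA : forall x : H,
    tensor_assoc (tensor_map comul idfun (comul x)) =
    tensor_map idfun comul (comul x);
  counitl : forall x : H, tensor_lift (fun a b => counit a *: b) (comul x) = x;
  counitr : forall x : H, tensor_lift (fun a b => counit b *: a) (comul x) = x
}.

#[short(type="comBialgType")]
HB.structure Definition ComBialgebra (K : fieldType) :=
  { H of isComBialgebra K H & GRing.ComAlgebra K H }.

Arguments comul {K s}.
Arguments counit {K s}.

Section Cocycles.
Variables (K : fieldType) (H : comBialgType K).

(* HZ^1_epsilon(H) consists of the linear maps L : H -> H satisfying          *)
(* [is_cocycle].                                                             *)
Definition is_cocycle (L : H -> H) : Prop :=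
  forall x, comul (L x) = tensor_map idfun L (comul x) + tens (L x) 1.

(* (id (x) alpha) \o Delta - alpha(_) 1, with H (x) K identified with H.      *)
Definition coboundary (alpha : H -> K) (x : H) : H :=
  tensor_lift (fun a b => alpha b *: a) (comul x) - (alpha x)%:A.

Fact coboundary_is_linear (alpha : {scalar H}) : linear (coboundary alpha).
Proof.
have abil : bilinear_for *:%R *:%R (fun a b => alpha b *: a : H).
  split=> [b|a] k x y /=; first by rewrite scalerDr !scalerA mulrC.
  by rewrite linearP scalerDl scalerA.
move=> k x y; rewrite /coboundary !linearP /= (tensor_liftP abil).
by rewrite scalerBr scalerDl opprD addrACA scalerA.
Qed.

HB.instance Definition _ (alpha : {scalar H}) := GRing.isLinear.Build K H H
  *:%R (coboundary alpha) (coboundary_is_linear alpha).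

End Cocycles.

(* A finite tree with a root and a linear order on the children of each node; *)
(* the unordered rooted trees are the classes of [ptree_iso], which is        *)
(* generated by permuting children and replacing a child by an isomorphic    *)
(* tree (the head child suffices, up to permutation).                        *)
Inductive ptree : Type := PNode of seq ptree.

HB.instance Definition _ := gen_eqMixin ptree.
HB.instance Definition _ := gen_choiceMixin ptree.

Inductive ptree_iso : ptree -> ptree -> Prop :=
| ptree_iso_perm s t : perm_eq s t -> ptree_iso (PNode s) (PNode t)
| ptree_iso_child x y s :
    ptree_iso x y -> ptree_iso (PNode (x :: s)) (PNode (y :: s))
| ptree_iso_trans x y z : ptree_iso x y -> ptree_iso y z -> ptree_iso x z.

Definition ptree_isob (x y : ptree) : bool := `[< ptree_iso x y >].

Lemma ptree_iso_refl x : ptree_iso x x.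
Proof. by case: x => s; apply: ptree_iso_perm. Qed.

Lemma ptree_iso_sym x y : ptree_iso x y -> ptree_iso y x.
Proof.
elim=> [s t st|{}x {}y s _ IH|{}x {}y z _ IHxy _ IHyz].
- by apply: ptree_iso_perm; rewrite perm_sym.
- exact: ptree_iso_child.
- exact: ptree_iso_trans IHyz IHxy.
Qed.

Fact ptree_isob_equiv : equiv_class_of ptree_isob.
Proof.
split=> [x|x y|y x z]; first by apply/asboolP; exact: ptree_iso_refl.
  by apply/asboolP/asboolP; exact: ptree_iso_sym.
by move=> /asboolP xy /asboolP yz; apply/asboolP; exact: ptree_iso_trans yz.
Qed.

Canonical ptree_isob_equiv_rel := EquivRelPack ptree_isob_equiv.

Definition rtree : Type := {eq_quot ptree_isob}.

HB.instance Definition _ := Choice.on rtree.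

HB.lock Definition tree_class (t : ptree) : rtree := \pi_({eq_quot ptree_isob}) t.
HB.lock Definition tree_repr (t : rtree) : ptree := repr (t : {eq_quot ptree_isob}).

Lemma tree_reprK t : tree_class (tree_repr t) = t.
Proof. by rewrite tree_class.unlock tree_repr.unlock; exact: reprK. Qed.

Lemma tree_classP x y : tree_class x = tree_class y <-> ptree_iso x y.
Proof.
rewrite tree_class.unlock.
split=> [/eqmodP/asboolP //|xy]; by apply/eqmodP/asboolP.
Qed.

(* Finite multisets of rooted trees, [mone] being the empty forest. *)
Definition forest : Type := {cmonom rtree}.

HB.instance Definition _ := ConomialDef.on forest.

Definition forest_trees (f : forest) : seq rtree :=
  flatten [seq nseq (f t) t | t <- finsupp f].

Definition forest_of (s : seq rtree) : forest :=
  \big[mmul/mone]_(t <- s) ucm t.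

Lemma forest_of_cons t s : forest_of (t :: s) = mmul (ucm t) (forest_of s).
Proof. by rewrite /forest_of big_cons. Qed.

Lemma forest_ofE s t : forest_of s t = count_mem t s.
Proof.
elim: s => [|u s IHs] /=; first by rewrite /forest_of big_nil cm1.
by rewrite forest_of_cons cmM IHs cmU.
Qed.

Lemma count_forest_trees f t : count_mem t (forest_trees f) = f t.
Proof.
rewrite /forest_trees count_flatten -map_comp sumnE big_map.
under eq_bigr => u _ do rewrite /= count_nseq /=.
have [tf|tf] := boolP (t \in finsupp f); last first.
  have /eqP -> : f t == 0%N by rewrite cmE_eq0.
  rewrite big_seq big1 // => u uf; case: eqP => [ut|]; last by rewrite mul0n.
  by move: tf; rewrite -ut uf.
rewrite (big_fsetD1 t) //= eqxx mul1n big_seq big1 ?addn0 // => u.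
by rewrite !inE => /andP[/negPf -> _]; rewrite mul0n.
Qed.

Lemma forest_of_trees f : forest_of (forest_trees f) = f.
Proof. by apply/eqP/cmP => t; rewrite forest_ofE count_forest_trees. Qed.

Lemma perm_forest_trees s : perm_eq (forest_trees (forest_of s)) s.
Proof.
by apply/allP => t _ /=; rewrite count_forest_trees forest_ofE.
Qed.

(* The tree whose root has the trees of f as children. *)
Definition graft (f : forest) : rtree :=
  tree_class (PNode [seq tree_repr t | t <- forest_trees f]).

Lemma ptree_iso_cons x y s t : ptree_iso x y ->
  ptree_iso (PNode s) (PNode t) -> ptree_iso (PNode (x :: s)) (PNode (y :: t)).
Proof.
move=> xy st; apply: ptree_iso_trans (ptree_iso_child s xy) _.
suff H a b : ptree_iso a b ->
    let: PNode u := a in let: PNode v := b in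
    ptree_iso (PNode (y :: u)) (PNode (y :: v)) by exact: H st.
elim=> [u v uv|c d u cd _|[u] [v] [w] _ IH1 _ IH2].
- by apply: ptree_iso_perm; rewrite perm_cons.
- apply: (@ptree_iso_trans _ (PNode (c :: y :: u))).
    by apply: ptree_iso_perm; apply/permP => p /=; rewrite addnCA.
  apply: (@ptree_iso_trans _ (PNode (d :: y :: u))); first exact: ptree_iso_child.
  by apply: ptree_iso_perm; apply/permP => p /=; rewrite addnCA.
- exact: ptree_iso_trans IH1 IH2.
Qed.

Lemma graft_class s :
  graft (forest_of (map tree_class s)) = tree_class (PNode s).
Proof.
apply/tree_classP; set s' := map tree_class s.
apply: (@ptree_iso_trans _ (PNode (map tree_repr s'))).
  by apply: ptree_iso_perm; apply: perm_map; exact: perm_forest_trees.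
rewrite /s'; elim: s {s'} => [|x s IHs] /=; first exact: ptree_iso_refl.
by apply: ptree_iso_cons => //; apply/tree_classP; rewrite tree_reprK.
Qed.

Lemma ptree_mem_ind (P : ptree -> Prop) :
  (forall s, (forall t, t \in s -> P t) -> P (PNode s)) -> forall t, P t.
Proof.
move=> IH; fix rec 1 => -[s]; apply: IH.
elim: s => [|x s IHs] t; first by rewrite in_nil; discriminate.
rewrite in_cons; case/orP; last exact: IHs.
by move/eqP ->; exact: (rec x).
Qed.

(* The free commutative algebra on rtree: the monoid algebra of the free      *)
(* commutative monoid of forests. Its product is that of {malg K[forest]},    *)
(* locked to keep unification from unfolding it.                             *)
Definition HR (K : fieldType) : Type := {malg K[forest]}.

HB.instance Definition _ (K : fieldType) := GRing.Lmodule.on (HR K).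

HB.lock Definition HR_mul (K : fieldType) (x y : HR K) : HR K :=
  (x : {malg K[forest]}) * (y : {malg K[forest]}).
Arguments HR_mul {K} x y.

HB.lock Definition forest_elt (K : fieldType) (f : forest) : HR K := << f >>.
Arguments forest_elt {K} f.

Lemma forest_eltE (K : fieldType) f :
  forest_elt f = << f >> :> {malg K[forest]}.
Proof. by rewrite forest_elt.unlock. Qed.

Section HRAlgebra.
Variable K : fieldType.
Implicit Types x y z : HR K.

Fact HR_mulA : associative (@HR_mul K).
Proof. rewrite HR_mul.unlock; exact: (@mulrA {malg K[forest]}). Qed.
Fact HR_mulC : commutative (@HR_mul K).
Proof. rewrite HR_mul.unlock; exact: (@mulrC {malg K[forest]}). Qed.
Fact HR_mul1 : left_id (forest_elt mone) (@HR_mul K).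
Proof.
rewrite HR_mul.unlock forest_elt.unlock; exact: (@mul1r {malg K[forest]}).
Qed.
Fact HR_mulDl : left_distributive (@HR_mul K) +%R.
Proof. rewrite HR_mul.unlock; exact: (@mulrDl {malg K[forest]}). Qed.
Fact HR_1_neq0 : (forest_elt mone : HR K) != 0.
Proof. rewrite forest_elt.unlock; exact: (@oner_neq0 {malg K[forest]}). Qed.

HB.instance Definition _ := GRing.Zmodule_isComNzRing.Build (HR K)
  HR_mulA HR_mulC HR_mul1 HR_mulDl HR_1_neq0.

Lemma HR_mulE x y :
  x * y = (x : {malg K[forest]}) * (y : {malg K[forest]}) :> {malg K[forest]}.
Proof. by rewrite -[LHS]/(HR_mul x y) HR_mul.unlock. Qed.

Fact HR_scaleAl k x y : k *: HR_mul x y = HR_mul (k *: x) y.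
Proof.
rewrite HR_mul.unlock; exact: (@scalerAl K {malg K[forest]}).
Qed.

HB.instance Definition _ := GRing.Lmodule_isLalgebra.Build K (HR K) HR_scaleAl.
HB.instance Definition _ := GRing.Lalgebra_isComAlgebra.Build K (HR K).

End HRAlgebra.

Section HRTheory.
Variable K : fieldType.
Local Notation HR := (HR K).
Implicit Types x y : HR.

Definition tree_elt (t : rtree) : HR := forest_elt (ucm t).

Definition Bplus (x : HR) : HR := lin_ext (fun f => tree_elt (graft f)) x.

Fact Bplus_is_linear : linear Bplus.
Proof. exact: lin_ext_is_linear. Qed.

HB.instance Definition _ := GRing.isLinear.Build K HR HR *:%R Bplus Bplus_is_linear.

Lemma Bplus_forest f : Bplus (forest_elt f) = tree_elt (graft f).
Proof. by rewrite [forest_elt f]forest_eltE; exact: lin_extU. Qed.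

Lemma forest_elt1 : forest_elt mone = 1 :> HR. Proof. by []. Qed.

Lemma forest_eltM f g :
  forest_elt (mmul f g) = forest_elt f * forest_elt g :> HR.
Proof.
by rewrite [RHS]HR_mulE !forest_eltE [RHS]fgmulUU mulr1.
Qed.

Lemma forest_elt_of s : forest_elt (forest_of s) = \prod_(t <- s) tree_elt t.
Proof.
elim: s => [|t s IHs]; first by rewrite big_nil /forest_of big_nil forest_elt1.
by rewrite big_cons forest_of_cons forest_eltM IHs.
Qed.

Lemma tree_elt_class s :
  tree_elt (tree_class (PNode s)) =
  Bplus (\prod_(x <- s) tree_elt (tree_class x)).
Proof. by rewrite -graft_class -Bplus_forest forest_elt_of big_map. Qed.

Lemma HR_forest_ind (P : HR -> Prop) :
  (forall k x y, P x -> P y -> P (k *: x + y)) ->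
  (forall f, P (forest_elt f)) -> forall x, P x.
Proof.
move=> Plin Pf x; rewrite [x]monalgE.
have P0 : P 0.
  by have := Plin (-1) _ _ (Pf mone) (Pf mone); rewrite scaleN1r addNr.
elim: (msupp _ : seq _) => [|f s IHs]; first by rewrite big_nil; exact: P0.
rewrite big_cons; set c := _@_f.
have -> : << c *g f >> = c *: forest_elt f.
  by rewrite forest_eltE; apply/malgP => k; rewrite mcoeffZ !mcoeffU mulrnAr mulr1.
apply: Plin; [exact: Pf | exact: IHs].
Qed.

Lemma HR_ind (P : HR -> Prop) :
  (forall k x y, P x -> P y -> P (k *: x + y)) -> P 1 ->
  (forall x y, P x -> P y -> P (x * y)) -> (forall x, P x -> P (Bplus x)) ->
  forall x, P x.
Proof.
move=> Plin P1 PM PB.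
have Ptree t : P (tree_elt t).
  rewrite -[t]tree_reprK; elim/ptree_mem_ind: (tree_repr t) => s IHs.
  rewrite tree_elt_class; apply: PB.
  elim: s IHs => [|x s IHs] H; first by rewrite big_nil; exact: P1.
  rewrite big_cons; apply: PM; first by apply: H; exact: mem_head.
  by apply: IHs => t' ts; apply: H; rewrite in_cons ts orbT.
have Pforest f : P (forest_elt f).
  rewrite -[f]forest_of_trees forest_elt_of.
  elim: (forest_trees f) => [|t s IHs]; first by rewrite big_nil; exact: P1.
  rewrite big_cons; apply: PM; [exact: Ptree | exact: IHs].
exact: HR_forest_ind.
Qed.

(* The algebra morphism HR -> A extending h : rtree -> A. *)
Definition HR_ext (A : comAlgType K) (h : rtree -> A) : HR -> A :=
  lin_ext (fun f : forest => \prod_(t <- forest_trees f) h t).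

Section Ext.
Variables (A : comAlgType K) (h : rtree -> A).

Fact HR_ext_is_linear : linear (HR_ext h).
Proof. exact: lin_ext_is_linear. Qed.

HB.instance Definition _ := GRing.isLinear.Build K HR A *:%R (HR_ext h)
  HR_ext_is_linear.

Lemma HR_extP k x y : HR_ext h (k *: x + y) = k *: HR_ext h x + HR_ext h y.
Proof. exact: HR_ext_is_linear. Qed.

Lemma HR_ext_forest s : HR_ext h (forest_elt (forest_of s)) = \prod_(t <- s) h t.
Proof.
rewrite forest_eltE [LHS](@lin_extU K forest A); apply: perm_big; exact: perm_forest_trees.
Qed.

Lemma HR_ext_tree t : HR_ext h (tree_elt t) = h t.
Proof.
have -> : tree_elt t = forest_elt (forest_of [:: t]).
  by rewrite forest_elt_of big_seq1.
by rewrite HR_ext_forest big_seq1.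
Qed.

Fact HR_ext_is_monoid_morphism : monoid_morphism (HR_ext h).
Proof.
split=> [|x y].
  have -> : 1 = forest_elt (forest_of [::]) :> HR by rewrite forest_elt_of big_nil.
  by rewrite HR_ext_forest big_nil.
elim/HR_forest_ind: x => [k x x' IH IH'|f].
  by rewrite mulrDl -scalerAl HR_extP [LHS]HR_extP IH IH' mulrDl -scalerAl.
elim/HR_forest_ind: y => [k y y' IH IH'|g].
  by rewrite mulrDr -scalerAr HR_extP [LHS]HR_extP IH IH' mulrDr -scalerAr.
rewrite -(forest_of_trees f) -(forest_of_trees g) !HR_ext_forest.
by rewrite !forest_elt_of -big_cat -forest_elt_of HR_ext_forest big_cat.
Qed.

HB.instance Definition _ := GRing.isMonoidMorphism.Build HR A (HR_ext h)
  HR_ext_is_monoid_morphism.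

End Ext.

Fixpoint ptree_eval (A : comAlgType K) (L : A -> A) (t : ptree) : A :=
  let: PNode s := t in L (\prod_(x <- map (ptree_eval L) s) x).

(* The algebra morphism rho with rho \o Bplus = L \o rho, characterized for   *)
(* linear L by [induced_Bplus] and [induced_unique]: the value at a tree with *)
(* children t_1, ..., t_n is L (rho t_1 * ... * rho t_n).                     *)
Definition induced (A : comAlgType K) (L : A -> A) : HR -> A :=
  HR_ext (fun t => ptree_eval L (tree_repr t)).

HB.instance Definition _ (A : comAlgType K) (L : A -> A) :=
  GRing.LRMorphism.on (induced L).

Lemma induced_Bplus (A : comAlgType K) (L : {linear A -> A}) x :
  induced L (Bplus x) = L (induced L x).
Proof.
have inv t u : ptree_iso t u -> ptree_eval L t = ptree_eval L u.
  elim=> [s s' ss'|a b s _ IH|a b c _ -> _ ->] //=.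
    by congr (L _); apply: perm_big; exact: perm_map.
  by rewrite !big_cons IH.
have treeE t : induced L (tree_elt (tree_class t)) = ptree_eval L t.
  by rewrite [LHS]HR_ext_tree; apply: inv; apply/tree_classP; rewrite tree_reprK.
elim/HR_forest_ind: x => [k x y IHx IHy|f].
  by rewrite !linearP /= IHx IHy.
rewrite Bplus_forest treeE /= !big_map; congr (L _).
by rewrite -{2}[f]forest_of_trees [RHS]HR_ext_forest.
Qed.

Lemma induced_unique (A : comAlgType K) (L : {linear A -> A})
    (phi : {lrmorphism HR -> A}) :
  (forall x, phi (Bplus x) = L (phi x)) -> phi =1 induced L.
Proof.
move=> phiB; elim/HR_ind => [k x y IHx IHy||x y IHx IHy|x IHx].
- by rewrite !linearP /= IHx IHy.
- by rewrite !rmorph1.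
- by rewrite !rmorphM /= IHx IHy.
- by rewrite phiB induced_Bplus IHx.
Qed.

Fixpoint ptree_comul (t : ptree) : tensor HR HR :=
  let: PNode s := t in
  tens (tree_elt (tree_class t)) 1 +
  tensor_map idfun Bplus (\prod_(x <- map ptree_comul s) x).

(* The algebra morphism Delta with Delta (Bplus x) =                          *)
(* Bplus x (x) 1 + (id (x) Bplus) (Delta x), characterized by                 *)
(* [HR_comul_Bplus] and [HR_comul_unique].                                   *)
Definition HR_comul : HR -> tensor HR HR :=
  HR_ext (fun t => ptree_comul (tree_repr t)).

HB.instance Definition _ := GRing.LRMorphism.on HR_comul.

Lemma HR_comulP k x y :
  HR_comul (k *: x + y) = k *: HR_comul x + HR_comul y.
Proof. exact: HR_extP. Qed.

Lemma BplusP k x y : Bplus (k *: x + y) = k *: Bplus x + Bplus y.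
Proof. exact: Bplus_is_linear. Qed.

Lemma HR_comul_Bplus x :
  HR_comul (Bplus x) = tens (Bplus x) 1 + tensor_map idfun Bplus (HR_comul x).
Proof.
have inv t u : ptree_iso t u -> ptree_comul t = ptree_comul u.
  elim=> [s s' ss'|a b s ab IH|a b c _ -> _ ->] //=.
    have /tree_classP -> := ptree_iso_perm ss'.
    by rewrite (perm_big _ (perm_map ptree_comul ss')).
  have /tree_classP -> := ptree_iso_child s ab.
  by rewrite !big_cons IH.
have treeE t : HR_comul (tree_elt (tree_class t)) = ptree_comul t.
  by rewrite [LHS]HR_ext_tree; apply: inv; apply/tree_classP; rewrite tree_reprK.
elim/HR_forest_ind: x => [k x y IHx IHy|f].
  rewrite BplusP [LHS]HR_comulP IHx IHy HR_comulP tensPl.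
  by rewrite tensor_mapP scalerDr addrACA.
rewrite Bplus_forest treeE /= !big_map; congr (_ + _).
by rewrite -[in RHS](forest_of_trees f) [HR_comul _]HR_ext_forest.
Qed.

Lemma HR_comul_unique (D : {lrmorphism HR -> tensor HR HR}) :
  (forall x, D (Bplus x) = tens (Bplus x) 1 + tensor_map idfun Bplus (D x)) ->
  D =1 HR_comul.
Proof.
move=> DB; elim/HR_ind => [k x y IHx IHy||x y IHx IHy|x IHx].
- by rewrite !linearP /= IHx IHy.
- by rewrite !rmorph1.
- by rewrite !rmorphM /= IHx IHy.
- by rewrite DB HR_comul_Bplus IHx.
Qed.

(* The coefficient of the empty forest. *)
Definition HR_counit (x : HR) : K := (x : {malg K[forest]})@_mone.

Lemma HR_counit_forest f : HR_counit (forest_elt f) = (f == mone)%:R.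
Proof. by rewrite /HR_counit forest_eltE mcoeffU. Qed.

Fact HR_counit_is_scalar : scalar HR_counit.
Proof. by move=> k x y; rewrite /HR_counit mcoeffD mcoeffZ. Qed.

Fact HR_counit_is_monoid_morphism : monoid_morphism HR_counit.
Proof.
split=> [|x y]; first by rewrite -forest_elt1 HR_counit_forest eqxx.
rewrite HR_mulE; exact: (rmorphM (mcoeff (mone : forest))).
Qed.

HB.instance Definition _ := GRing.isLinear.Build K HR K *%R HR_counit
  HR_counit_is_scalar.
HB.instance Definition _ := GRing.isMonoidMorphism.Build HR K HR_counit
  HR_counit_is_monoid_morphism.

Let scalel_bil (e : {scalar HR}) :
  bilinear_for *:%R *:%R (fun a b => e a *: b : HR).
Proof.
split=> [b|a] k x y /=; first by rewrite linearP scalerDl scalerA.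
by rewrite scalerDr !scalerA mulrC.
Qed.

Let scaler_bil (e : {scalar HR}) :
  bilinear_for *:%R *:%R (fun a b => e b *: a : HR).
Proof.
split=> [b|a] k x y /=; first by rewrite scalerDr !scalerA mulrC.
by rewrite linearP scalerDl scalerA.
Qed.

Local Notation id2 := (@idfun HR).
Local Notation lB := (tensor_map id2 Bplus).

Let lB_tens a b : lB (tens a b) = tens a (Bplus b).
Proof. exact: tensor_mapE. Qed.

Let counit_l X : tensor_lift (fun a b => HR_counit a *: b) (lB X) =
  Bplus (tensor_lift (fun a b => HR_counit a *: b) X).
Proof.
elim/tensor_ind: X => [k x y IHx IHy|a b].
  rewrite [lB (_ + _)]tensor_mapP !(tensor_liftP (scalel_bil HR_counit)) IHx IHy.
  by rewrite BplusP.
by rewrite lB_tens !(tensor_liftE (scalel_bil HR_counit)) linearZ.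
Qed.

Let counit_Bplus x : HR_counit (Bplus x) = 0.
Proof.
elim/HR_forest_ind: x => [k x y IHx IHy|f].
  by rewrite BplusP HR_counit_is_scalar IHx IHy mulr0 addr0.
rewrite Bplus_forest HR_counit_forest; case: eqP => //; set t := graft f.
by move/(congr1 (fun g : forest => g t)); rewrite cmUU cm1.
Qed.

Fact HR_counitl x : tensor_lift (fun a b => HR_counit a *: b) (HR_comul x) = x.
Proof.
elim/HR_ind: x => [k x y IHx IHy||x y IHx IHy|x IHx].
- by rewrite HR_comulP (tensor_liftP (scalel_bil HR_counit)) IHx IHy.
- rewrite rmorph1 -tens1 (tensor_liftE (scalel_bil HR_counit)).
  by rewrite rmorph1 scale1r.
- rewrite rmorphM -[in RHS]IHx -[in RHS]IHy /=.
  elim/tensor_ind: (HR_comul x) => [k X X' IH IH'|a b].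
    rewrite mulrDl -scalerAl !(tensor_liftP (scalel_bil HR_counit)) IH IH'.
    by rewrite mulrDl -scalerAl.
  elim/tensor_ind: (HR_comul y) => [k X X' IH IH'|c d].
    rewrite mulrDr -scalerAr !(tensor_liftP (scalel_bil HR_counit)) IH IH'.
    by rewrite mulrDr -scalerAr.
  rewrite tensM !(tensor_liftE (scalel_bil HR_counit)) rmorphM /=.
  by rewrite -scalerAl -scalerAr scalerA.
- rewrite HR_comul_Bplus -[tens _ _]scale1r (tensor_liftP (scalel_bil HR_counit)).
  rewrite (tensor_liftE (scalel_bil HR_counit)) /= counit_Bplus scale0r scaler0.
  by rewrite add0r counit_l IHx.
Qed.

Let counit_r X : tensor_lift (fun a b => HR_counit b *: a) (lB X) = 0.
Proof.
elim/tensor_ind: X => [k x y IHx IHy|a b].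
  rewrite [lB (_ + _)]tensor_mapP (tensor_liftP (scaler_bil HR_counit)) IHx IHy.
  by rewrite scaler0 addr0.
by rewrite lB_tens (tensor_liftE (scaler_bil HR_counit)) /= counit_Bplus scale0r.
Qed.

Fact HR_counitr x : tensor_lift (fun a b => HR_counit b *: a) (HR_comul x) = x.
Proof.
elim/HR_ind: x => [k x y IHx IHy||x y IHx IHy|x IHx].
- by rewrite HR_comulP (tensor_liftP (scaler_bil HR_counit)) IHx IHy.
- rewrite rmorph1 -tens1 (tensor_liftE (scaler_bil HR_counit)).
  by rewrite rmorph1 scale1r.
- rewrite rmorphM -[in RHS]IHx -[in RHS]IHy /=.
  elim/tensor_ind: (HR_comul x) => [k X X' IH IH'|a b].
    rewrite mulrDl -scalerAl !(tensor_liftP (scaler_bil HR_counit)) IH IH'.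
    by rewrite mulrDl -scalerAl.
  elim/tensor_ind: (HR_comul y) => [k X X' IH IH'|c d].
    rewrite mulrDr -scalerAr !(tensor_liftP (scaler_bil HR_counit)) IH IH'.
    by rewrite mulrDr -scalerAr.
  rewrite tensM !(tensor_liftE (scaler_bil HR_counit)) rmorphM /=.
  by rewrite -scalerAl -scalerAr scalerA.
- rewrite HR_comul_Bplus -[tens _ _]scale1r (tensor_liftP (scaler_bil HR_counit)).
  rewrite (tensor_liftE (scaler_bil HR_counit)) /= counit_r rmorph1 !scale1r.
  by rewrite addr0.
Qed.

Local Notation Dl := (tensor_map HR_comul id2).
Local Notation Dr := (tensor_map id2 HR_comul).
Local Notation llB := (tensor_map id2 lB).

Let Dr_lB X :
  Dr (lB X) = tensor_assoc (tens (lB X) 1) + llB (Dr X).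
Proof.
elim/tensor_ind: X => [k x y IHx IHy|a b].
  rewrite [lB (_ + _)]tensor_mapP [LHS]tensor_mapP IHx IHy.
  rewrite tensPl [tensor_assoc (_ + _)]tensor_assocP [Dr (_ + _)]tensor_mapP.
  by rewrite [llB (_ + _)]tensor_mapP scalerDr addrACA.
rewrite lB_tens !tensor_mapE tensor_assocE /= HR_comul_Bplus.
by rewrite -[tens (Bplus b) 1]scale1r tensPr !scale1r.
Qed.

Let assoc_lB X : tensor_assoc (Dl (lB X)) = llB (tensor_assoc (Dl X)).
Proof.
elim/tensor_ind: X => [k x y IHx IHy|a b].
  rewrite [lB (_ + _)]tensor_mapP [Dl (_ + _)]tensor_mapP [LHS]tensor_assocP IHx IHy.
  rewrite [Dl (_ + _)]tensor_mapP [tensor_assoc (_ + _)]tensor_assocP.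
  by rewrite [llB (_ + _)]tensor_mapP.
rewrite lB_tens !tensor_mapE /=.
elim/tensor_ind: (HR_comul a) => [k x y IHx IHy|c d].
  rewrite !tensPl [LHS]tensor_assocP IHx IHy [tensor_assoc (_ + _)]tensor_assocP.
  by rewrite [llB (_ + _)]tensor_mapP.
by rewrite !tensor_assocE tensor_mapE /= lB_tens.
Qed.

Fact HR_comulA x : tensor_assoc (Dl (HR_comul x)) = Dr (HR_comul x).
Proof.
elim/HR_ind: x => [k x y IHx IHy||x y IHx IHy|x IHx].
- rewrite HR_comulP [Dl (_ + _)]tensor_mapP [LHS]tensor_assocP IHx IHy.
  by rewrite [RHS]tensor_mapP.
- by rewrite !rmorph1.
- by rewrite !rmorphM /= IHx IHy.
- rewrite HR_comul_Bplus [Dl (_ + _)]linearD /= [LHS]linearD /=.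
  rewrite [Dr (_ + _)]linearD /= assoc_lB IHx Dr_lB addrA; congr (_ + _).
  rewrite !tensor_mapE /= HR_comul_Bplus -[tens (Bplus x) 1]scale1r tensPl scale1r.
  rewrite [LHS]linearD /= tensor_assocE; congr (tens _ _ + _).
  by rewrite rmorph1.
Qed.

HB.instance Definition _ := isComBialgebra.Build K HR
  HR_comulA HR_counitl HR_counitr.

Lemma comul_HRE : (comul : HR -> tensor HR HR) =1 HR_comul.
Proof. by []. Qed.

(* The endomorphism of HR attached to beta in HR'; see [chi_Bplus]. *)
Definition chi (beta : HR -> K) : HR -> HR :=
  induced (Bplus \+ coboundary beta).

HB.instance Definition _ (beta : HR -> K) := GRing.LRMorphism.on (chi beta).

Lemma chi_Bplus (beta : {scalar HR}) x :
  chi beta (Bplus x) = Bplus (chi beta x) + coboundary beta (chi beta x).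
Proof. exact: (induced_Bplus (Bplus \+ coboundary beta)). Qed.

End HRTheory.

(* Main.v *)
Require Import Defs.
From mathcomp Require Import all_boot all_algebra.

(** By uniqueness of induced morphisms, it suffices that the algebra morphism
    rho \o chi on the right, with rho := induced L and beta := alpha \o rho,
    intertwines [Bplus] with L + d(alpha), where d denotes [coboundary].
    Applying rho to chi \o Bplus = (Bplus + d(beta)) \o chi turns [Bplus] into
    L, so what is left is rho \o d(alpha \o rho) = d(alpha) \o rho.  This
    naturality of the coboundary ([coboundary_natural]) holds for every algebra
    morphism that respects the coproducts, since d(alpha) is built from the
    coproduct and the unit alone.  That rho respects the coproducts
    ([induced_comul]) is where the cocycle equation of L enters: it has the
    same shape as the recursion that defines the coproduct of [HR] on the image
    of [Bplus]. *)

Import GRing.Theory.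

Local Open Scope ring_scope.

(** Both sides are algebra morphisms in x, and [HR] is the smallest subspace
    that contains 1 and is stable under products and [Bplus]; so the point is to
    pass from x to [Bplus x].  There the cocycle equation of L on [H] and the
    recursion for the coproduct on [HR] have matching terms, because [induced L]
    turns [Bplus] into L. *)
Lemma induced_comul {K : fieldType} {H : comBialgType K}
    {L : {linear H -> H}} : is_cocycle L ->
  forall x, comul (induced L x) =
            tensor_map (induced L) (induced L) (comul x).
Proof.
move=> cocycleL.
have mapL X : tensor_map idfun L (tensor_map (induced L) (induced L) X) =
  tensor_map (induced L) (induced L) (tensor_map idfun (@Bplus K) X).
  elim/tensor_ind: X => [k X Y IHX IHY|u v].
    by rewrite !tensor_mapP IHX IHY.
  by rewrite !tensor_mapE /= induced_Bplus.
elim/HR_ind => [k x y IHx IHy||x y IHx IHy|x IHx].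
- by rewrite !linearP /= IHx IHy.
- by rewrite !rmorph1.
- by rewrite !rmorphM /= IHx IHy.
- rewrite induced_Bplus cocycleL IHx [comul (Bplus _)]HR_comul_Bplus.
  rewrite [RHS]linearD /= [RHS]addrC tensor_mapE /= induced_Bplus rmorph1.
  congr (_ + _); exact: mapL.
Qed.

(** By the hypothesis, phi carries (id (x) (alpha \o phi)) \o comul to
    (id (x) alpha) \o comul \o phi; the subtracted multiple of 1 is respected
    because phi 1 = 1. *)
Lemma coboundary_natural {K : fieldType} {C H : comBialgType K}
    (phi : {lrmorphism C -> H}) (alpha : {scalar H}) :
  (forall x, comul (phi x) = tensor_map phi phi (comul x)) ->
  forall x, phi (coboundary (alpha \o phi) x) = coboundary alpha (phi x).
Proof.
have evalr_bilinear (B : comBialgType K) (e : {scalar B}) :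
    bilinear_for *:%R *:%R (fun a b : B => e b *: a).
  split=> [b|a] k x y /=; first by rewrite scalerDr !scalerA mulrC.
  by rewrite linearP scalerDl scalerA.
move=> phi_comul x; rewrite /coboundary phi_comul linearB linearZ /= rmorph1.
congr (_ - _).
elim/tensor_ind: (comul x) => [k y z IHy IHz|a b].
  rewrite tensor_mapP (tensor_liftP (evalr_bilinear C (alpha \o phi))).
  by rewrite (tensor_liftP (evalr_bilinear H alpha)) linearP /= IHy IHz.
rewrite tensor_mapE (tensor_liftE (evalr_bilinear C (alpha \o phi))).
by rewrite (tensor_liftE (evalr_bilinear H alpha)) linearZ.
Qed.

Theorem theorem2p4p8 (K : fieldType) (charK : [pchar K] =i pred0)
    (H : comBialgType K) (L : {linear H -> H}) (cocycleL : is_cocycle L)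
    (alpha : {scalar H}) :
  induced (L \+ coboundary alpha) =1 induced L \o chi (alpha \o induced L).
Proof.
move=> x; symmetry; move: x.
apply: (induced_unique (L := L \+ coboundary alpha)
                       (phi := induced L \o chi (alpha \o induced L))) => x /=.
rewrite chi_Bplus linearD /= induced_Bplus.
by rewrite (coboundary_natural _ _ (induced_comul cocycleL)).
Qed.
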